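(* Let $\alpha,\beta>0$ be rationally independent real numbers, and let $p,q\in\mathbb{C}$ be such that $(p,q)$ is not proportional to any vector of the form $(n,m)$ where $n,m$ are nonnegative integers. If a measurable function $f:\mathbb{R}\to\mathbb{C}$ satisfies $$\sum_{k\in\mathbb{Z}} f(x-k\alpha)=p,\qquad \sum_{k\in\mathbb{Z}} f(x-k\beta)=q\qquad\text{for a.e. } x\in\mathbb{R},$$ where both series converge absolutely for a.e. $x$, then $\operatorname{mes}(\operatorname{supp} f)\ge\alpha+\beta$.
   Context: Two positive real numbers $\alpha,\beta$ are rationally independent if $n\alpha+m\beta=0$ with $n,m\in\mathbb{Z}$ implies $n=m=0$ (equivalently, $\alpha/\beta$ is irrational). The support of a function $f$ is the set $\operatorname{supp} f=\{x: f(x)\ne 0\}$ (no closure is taken). $\operatorname{mes}$ denotes Lebesgue measure on $\mathbb{R}$. A vector $u\in\mathbb{C}^2$ is said to be proportional to a vector $v$ if $u=\lambda v$ for some scalar $\lambda\in\mathbb{C}$ (in particular $u=(0,0)$ is proportional to every $v$). *)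

(* Defs.v *)
From mathcomp Require Import all_boot all_order all_algebra.
From mathcomp Require Import all_classical all_reals all_analysis.
From mathcomp.analysis.showcase Require Import summability.
From mathcomp Require Import complex.

Set Implicit Arguments.
Unset Strict Implicit.
Unset Printing Implicit Defensive.

Import Order.TTheory GRing.Theory Num.Theory.
Import numFieldNormedType.Exports.

Local Open Scope classical_set_scope.
Local Open Scope ring_scope.

Definition rationally_independent (R : realType) (a b : R) : Prop :=
  forall n m : int, n%:~R * a + m%:~R * b = 0 -> n = 0 /\ m = 0.

Definition proportional (K : fieldType) (u v : K * K) : Prop :=
  exists l : K, u = (l * v.1, l * v.2).

(* Lebesgue measurability: the source carries the Lebesgue measurable sets, the
   domain of [completed_lebesgue_measure] (the library's [measurableTypeR R] has
   only the Borel sets), and the target the Borel sets of C, whose topology is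
   reached through the regular algebra [R[i]^o]. *)
Definition lebesgue_measurable_fun (R : realType) (f : R -> R[i]) : Prop :=
  measurable_fun setT
    (f : caratheodory_type (wlength (@idfun R))^*%mu ->
         g_sigma_algebraType (@open R[i]^o)).

(* The series of [a] over Z converges absolutely, with sum [s]. The sum is the
   limit along the finite subsets of Z ordered by inclusion, so that no
   enumeration of Z is singled out; [normc] is the modulus with values in R. *)
Definition abs_sums_to (R : realType) (a : int -> R[i]) (s : R[i]) : Prop :=
  esum.summable [set: int] (fun k => (ComplexField.Normc.normc (a k))%:E) /\
  partial_sum (a : int -> R[i]^o) @ totally --> (s : R[i]^o).

(* Main.v *)
Require Import Defs.
From mathcomp Require Import all_boot all_order all_algebra.
From mathcomp Require Import all_classical all_reals all_analysis.
From mathcomp Require Import measurable_realfun.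
From mathcomp.analysis.showcase Require Import summability.
From mathcomp Require Import complex.
From mathcomp Require finmap.
From mathcomp Require Import lra.

(* View the points of S = supp f as the edges of a bipartite graph whose
   vertices are the orbits in R / aZ and R / bZ (a = alpha, b = beta): f has sum
   p at every a-orbit and q at every b-orbit. Up to a null set the degrees are
   finite, since mes S may be assumed finite. A finite component with m
   a-vertices and n b-vertices would give m p = n q, which is excluded. Remove
   all edges that have an end of degree 1, together with these ends: no edge
   loses both ends and no remaining vertex is isolated, so equal measures of
   edges and of vertices disappear, and the difference
   D = mes(edges) - mes(vertices) = mes S - (a + b) is unchanged. Counting
   degrees gives 2 D >= - (measure of the leaves removed) in each round; the
   total measure of removed leaves is at most a + b, so n rounds give
   2 n D >= - (a + b) for every n, and D >= 0. *)

Set Implicit Arguments.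
Unset Strict Implicit.
Unset Printing Implicit Defensive.

Import Order.TTheory GRing.Theory Num.Theory.
Import numFieldNormedType.Exports.

Local Open Scope classical_set_scope.
Local Open Scope ring_scope.

(** * Orbits under the translations by multiples of one element *)

Section orbits.
Context {V : zmodType}.
Implicit Types (a b x : V) (E F : set V) (k : int).

Definition orbit_in a E x : set int := [set k | E (x - a *~ k)].

Definition saturation a E : set V := [set x | exists k, E (x - a *~ k)].

(** The edges whose [a]-vertex has degree 1, the degree being the number of indices in
    [orbit_in]. *)
Definition leaf a E : set V :=
  [set x | E x /\ forall k, E (x - a *~ k) -> k = 0].

Definition trim a b E : set V := E `\` (leaf a E `|` leaf b E).

Lemma trimC a b E : trim a b E = trim b a E.
Proof. by rewrite /trim setUC. Qed.

Lemma sub_saturation a E : E `<=` saturation a E.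
Proof. by move=> x Ex; exists 0; rewrite mulr0z subr0. Qed.

Lemma saturationS a E F : E `<=` F -> saturation a E `<=` saturation a F.
Proof. by move=> EF x [k Ek]; exists k; exact: EF. Qed.

Lemma saturation_shift a E x k :
  saturation a E (x - a *~ k) <-> saturation a E x.
Proof.
split=> -[j Ej]; [exists (k + j)|exists (j - k)].
  by rewrite mulrzDr opprD addrA.
by rewrite mulrzBr -addrA -opprD addrCA subrr addr0.
Qed.

Lemma orbit_in_shift a E x k :
  orbit_in a E (x - a *~ k) = [set j | orbit_in a E x (k + j)].
Proof.
by apply/seteqP; split=> j; rewrite /orbit_in /= mulrzDr opprD addrA.
Qed.

Lemma finite_orbit_in_shift a E x k :
  finite_set (orbit_in a E (x - a *~ k)) <-> finite_set (orbit_in a E x).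
Proof.
have sub y i : finite_set (orbit_in a E y) ->
    finite_set (orbit_in a E (y - a *~ i)).
  move=> fin; apply: (sub_finite_set _ (finite_image (fun j => j - i) fin)).
  move=> j; rewrite orbit_in_shift /= => Ej.
  by exists (i + j) => //; rewrite addrC addKr.
split; last exact: sub.
by move=> /(sub _ (- k)); rewrite mulrNz opprK subrK.
Qed.

Lemma leaf_saturation a E x : E x -> saturation a (leaf a E) x -> leaf a E x.
Proof.
move=> Ex [k Lk]; suff k0 : k = 0 by move: Lk; rewrite k0 mulr0z subr0.
by apply/eqP; rewrite -oppr_eq0; apply/eqP/Lk.2; rewrite mulrNz opprK subrK.
Qed.

Lemma leaf_orbit_in a E x : leaf a E x -> orbit_in a E x = [set 0].
Proof.
move=> [Ex x1]; apply/seteqP; split=> [k /x1//|_ ->].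
by rewrite /orbit_in /= mulr0z subr0.
Qed.

End orbits.

(** * Orbit sums under pruning *)

Section pruning.
Context {V W : zmodType} (f : V -> W).
Implicit Types (a b x : V) (p q : W) (E : set V).

(** Such a sum is 0 by default when infinitely many terms are nonzero, hence the finiteness clause
    in [pruned_sums]. *)
Definition orbit_sum a E x : W := \sum_(k \in orbit_in a E x) f (x - a *~ k).

(* In a graph with vertex sums [p] at the [a]-orbits and [q] at the [b]-orbits,
   of which the edges [E] remain after pruning, [m.+1] and [n] count the [a]-
   and [b]-vertices of the tree pruned onto the [a]-orbit of [x]. *)
Definition pruned_sums a p q E := forall x, E x ->
  finite_set (orbit_in a E x) /\
  exists m n : nat, orbit_sum a E x = p *+ m.+1 - q *+ n.

Lemma leaf_value {a p q E x} : pruned_sums a p q E -> leaf a E x ->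
  exists m n : nat, f x = p *+ m.+1 - q *+ n.
Proof.
move=> EP Lx; have [_ [m [n]]] := EP _ Lx.1; rewrite /orbit_sum leaf_orbit_in//.
by rewrite fsbig_set1 mulr0z subr0; exists m, n.
Qed.

Context {a b : V} {p q : W}.
Hypothesis pq_free : forall m n : nat, p *+ m = q *+ n -> m = 0%N /\ n = 0%N.

(** An edge in both sets would complete a finite component: its two expressions for [f x] give
    [p *+ (m.+1 + n') = q *+ (m'.+1 + n)], with positive multiples. *)
Lemma leaf_disjoint E : pruned_sums a p q E -> pruned_sums b q p E ->
  leaf a E `&` leaf b E = set0.
Proof.
move=> Ea Eb; rewrite -subset0 => x [/(leaf_value Ea)[m [n fx]]].
move=> /(leaf_value Eb)[m' [n' /eqP]]; rewrite fx
  subr_eq addrAC eq_sym subr_eq -!mulrnDr.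
by move=> /eqP/esym/pq_free[]; rewrite addSn.
Qed.

Lemma sum_leaf_values E (D : set int) x : pruned_sums b q p E ->
  finite_set D -> (forall k, D k -> leaf b E (x - a *~ k)) ->
  exists m n : nat, \sum_(k \in D) f (x - a *~ k) = q *+ m - p *+ n.
Proof.
move=> Eb finD DL; rewrite fsbig_finite//= big_seq.
elim/big_ind : _ => [|u v [m [n ->]] [m' [n' ->]]|k].
- by exists 0%N, 0%N; rewrite subr0.
- by exists (m + m')%N, (n + n')%N; rewrite !mulrnDr opprD addrACA.
- rewrite in_fset_set// inE => /DL /(leaf_value Eb)[m [n ->]].
  by exists m.+1, n.
Qed.

(** An [a]-vertex of degree at least 2 loses exactly its [b]-leaves. Subtracting their values grafts
    their trees onto it: the counts add up, and that of [p] stays positive. *)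
Lemma trim_orbit_sum E x : pruned_sums a p q E -> pruned_sums b q p E ->
  E x -> ~ leaf a E x -> finite_set (orbit_in a (trim a b E) x) /\
  exists m n : nat, orbit_sum a (trim a b E) x = p *+ m.+1 - q *+ n.
Proof.
move=> Ea Eb Ex nLx; have [finE [m [n sumE]]] := Ea x Ex.
(* An [a]-leaf on the orbit of [x] would be [x] itself, so only [b]-leaves disappear from this
   orbit. *)
have trimE : orbit_in a E x `&` ~` orbit_in a (leaf b E) x =
    orbit_in a (trim a b E) x.
  apply/seteqP; split=> k [Ek nLk]; split=> //; last first.
    by move=> Lk; apply: nLk; right.
  by case=> // Lk; apply/nLx/leaf_saturation => //; exists k.
split; first by rewrite -trimE; exact: finite_setIl.
have finL : finite_set (orbit_in a E x `&` orbit_in a (leaf b E) x).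
  exact: finite_setIl.
have [k []//|m' [n' sumL]] := sum_leaf_values (x := x) Eb finL.
exists (m + n')%N, (n + m')%N; move: sumE.
rewrite /orbit_sum (fsbigID (orbit_in a (leaf b E) x))//= sumL trimE.
move=> /eqP; rewrite addrC eq_sym -subr_eq => /eqP <-.
by rewrite opprB -addSn !mulrnDr opprD addrACA.
Qed.

Lemma pruned_sums_trim E : pruned_sums a p q E -> pruned_sums b q p E ->
  pruned_sums a p q (trim a b E).
Proof.
by move=> Ea Eb x [Ex nLx]; apply: trim_orbit_sum => // Lx; apply: nLx; left.
Qed.

(** Trimming isolates no vertex: a non-leaf vertex left without edges would have sum 0, hence
    [p *+ m.+1 = q *+ n]. *)
Lemma saturation_trim E : pruned_sums a p q E -> pruned_sums b q p E ->
  saturation a (trim a b E) = saturation a (E `\` leaf a E).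
Proof.
move=> Ea Eb; apply/seteqP; split.
  by apply: saturationS => x [Ex nLx]; split=> // Lx; apply: nLx; left.
move=> x [k [Ek nLk]]; apply/(saturation_shift _ _ _ k).
have [_ [m [n sumE]]] := trim_orbit_sum Ea Eb Ek nLk.
have [T0|/set0P[j Tj]] := eqVneq (orbit_in a (trim a b E) (x - a *~ k)) set0.
  move: sumE; rewrite /orbit_sum T0 fsbig_set0 => /esym/eqP.
  by rewrite subr_eq0 => /eqP/pq_free[].
by exists j.
Qed.

End pruning.

(** * Measure of a set covered twice *)

Section measure_multiplicity.
Context {d : measure_display} {T : measurableType d} {R : realType}.
Context (mu : {measure set T -> \bar R}).
Local Open Scope ereal_scope.

(* Split each [A n] into the points met for the first time and the others: both
   halves still cover [V]. *)
Lemma measure_covered_twice (V : set T) (A : (set T)^nat) :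
  measurable V -> (forall n, measurable (A n)) ->
  (forall x, V x -> exists m n, [/\ m <> n, A m x & A n x]) ->
  mu V + mu V <= \sum_(n <oo) mu (A n).
Proof.
move=> mV mA V2; pose U n := \bigcup_(k < n) A k.
have mU n : measurable (U n) by apply: bigcup_measurable.
have AU n : mu (A n) = mu (A n `\` U n) + mu (A n `&` U n).
  exact: measureDI.
under eq_eseriesr do rewrite AU.
rewrite nneseriesD//; apply: leeD.
- apply: measure_sigma_subadditive => //; first by move=> n; exact: measurableD.
  move=> x /V2[m [_ [_ Amx _]]].
  have [n An min_n] :=
    ex_minnP (ex_intro (fun n => `[< A n x >]) m (asboolT Amx)).
  exists n => //; split; first exact/asboolP.
  by move=> [k /= kn Akx]; move: (min_n _ (asboolT Akx)); rewrite leqNgt kn.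
- apply: measure_sigma_subadditive => //; first by move=> n; exact: measurableI.
  move=> x /V2[m [n [/eqP]]]; rewrite neq_ltn => /orP[] lt_mn Am An.
    by exists n => //; split=> //; exists m.
  by exists m => //; split=> //; exists n.
Qed.

End measure_multiplicity.

(** * Translation invariance of Lebesgue measure *)

Section translation.
Context {R : realType}.
Implicit Types (A E F : set R) (a b c x : R).
Notation mu := (@lebesgue_measure R).

Let measurable_subr c : measurable_fun setT (fun x : R => x - c).
Proof. exact: measurable_funB. Qed.

Lemma measurable_translate A c : measurable A -> measurable [set x | A (x - c)].
Proof. by move=> /(measurable_subr c measurableT); rewrite setTI. Qed.

Lemma lebesgue_measure_translate A c :
  measurable A -> mu [set x | A (x - c)] = mu A.
Proof.
move=> mA; apply/esym.
apply: (@lebesgue_measure_unique R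
  (pushforward mu ((fun x => x - c) : _ -> measurableTypeR R))) => //.
  exact: measurable_subr.
move=> ? _ [[u v]] _ <-; rewrite /pushforward /=.
rewrite [X in _ = mu X](_ : _ = `](u + c), (v + c)]%classic).
  rewrite !lebesgue_measure_itv /= !lte_fin ltrD2r -!EFinD.
  by rewrite opprD addrACA subrr addr0.
by apply/seteqP; split=> x; rewrite /= !in_itv /= ltrBrDr lerBlDr.
Qed.

End translation.

(** An enumeration of the integers, which turns sums over an orbit into series over [nat]. *)
Definition int_of_nat n : int := if odd n then Negz n./2 else Posz n./2.

Lemma int_of_nat_bij : bijective int_of_nat.
Proof.
exists (fun k => match k with Posz m => m.*2 | Negz m => m.*2.+1 end).
  move=> n; rewrite /int_of_nat -[RHS]odd_double_half.
  by case: (odd n).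
by case=> n; rewrite /int_of_nat /= odd_double /= ?uphalf_double ?doubleK.
Qed.

(** * Counting edges over a fundamental domain *)

Section fundamental_domain.
Context {R : realType}.
Implicit Types (E F : set R) (x y : R).
Notation mu := (@lebesgue_measure R).

Lemma measurable_saturation a E : measurable E -> measurable (saturation a E).
Proof.
move=> mE; have -> : saturation a E = \bigcup_k [set x | E (x - a *~ k)].
  by apply/seteqP; split=> x [k]; exists k.
apply: countable_bigcupT_measurable => [|k]; first exact: countableP.
exact: measurable_translate.
Qed.

Lemma measurable_leaf a E : measurable E -> measurable (leaf a E).
Proof.
move=> mE; have -> : leaf a E =
    E `\` \bigcup_(k in [set~ 0]) [set x | E (x - a *~ k)].
  apply/seteqP; split=> x [Ex xP]; split=> //; first by move=> [k + /xP].
  by move=> k Ek; apply: contrapT => k0; apply: xP; exists k.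
apply: measurableD => //; rewrite bigcup_mkcond.
apply: countable_bigcupT_measurable => [|k]; first exact: countableP.
by case: ifP => _ //; exact: measurable_translate.
Qed.

Lemma measurable_trim a b E : measurable E -> measurable (trim a b E).
Proof.
move=> mE; apply: measurableD => //.
by apply: measurableU; exact: measurable_leaf.
Qed.

(** The measure of the [a]-vertices of positive degree, with R / aZ represented by [[0, a[]. *)
Definition saturation_measure a E : \bar R := mu (`[0, a[ `&` saturation a E).

(** The part of [E] in one translate of [[0, a[], moved back; a point lies in as many tiles as its
    vertex has edges. *)
Let tile a E n : set R :=
  `[0, a[ `&` [set x | E (x - a *~ int_of_nat n)].

Let measurable_tile a E n : measurable E -> measurable (tile a E n).
Proof. by move=> mE; apply: measurableI => //; exact: measurable_translate. Qed.

Let bigcup_tile a E : \bigcup_n tile a E n = `[0, a[ `&` saturation a E.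
Proof.
have [g _ gK] := int_of_nat_bij.
apply/seteqP; split=> [x [n _ [xa Ex]]|x [xa [k Ek]]].
  by split=> //; exists (int_of_nat n).
by exists (g k) => //; split=> //; rewrite /= gK.
Qed.

Context {a : R} (a_gt0 : 0 < a).

Lemma fundamental_domainE x (k : int) :
  (x + a *~ k \in `[0, a[) = (Num.floor (x / a) == - k).
Proof.
rewrite floor_eq ler_pdivlMr// ltr_pdivrMr// !mulrzl mulrzDr mulr1z mulrNz.
by rewrite in_itv /= -lerBlDr sub0r -ltrBrDr [_ + a]addrC.
Qed.

(** The translates of [[0, a[] cut [E] into disjoint cells, and each tile is a translate of a cell.
    The series is the integral of the degree over the vertices. *)
Lemma measure_tiles E : measurable E ->
  (mu E = \sum_(n <oo) mu (tile a E n))%E.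
Proof.
move=> mE.
pose cell n := E `&` [set x | `[0, a[%classic (x + a *~ int_of_nat n)].
have cellE : E = \bigcup_n cell n.
  apply/seteqP; split=> [x Ex|x [n _ []//]].
  pose k := - Num.floor (x / a).
  have xk : x + a *~ k \in `[0, a[ by rewrite fundamental_domainE opprK.
  have [g _ gK] := int_of_nat_bij.
  by exists (g k) => //; split=> //; rewrite /= gK.
have tileE n : tile a E n = [set x | cell n (x - a *~ int_of_nat n)].
  by apply/seteqP; split=> x; rewrite /tile /cell /= subrK => -[].
have mcell n : measurable (cell n).
  apply: measurableI => //; have := measurable_itv `[0, a[.
  by move/(measurable_translate (- (a *~ int_of_nat n))); rewrite opprK.
rewrite [in LHS]cellE measure_semi_bigcup//.
- by apply: eq_eseriesr => n _; rewrite tileE lebesgue_measure_translate.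
- apply/trivIsetP => i j _ _ ij; rewrite -subset0 => x [[_ xi] [_ xj]].
  move/eqP: ij; apply; apply: (bij_inj int_of_nat_bij).
  apply: oppr_inj; move: xi xj.
  by rewrite /= !fundamental_domainE => /eqP <- /eqP.
- exact: bigcupT_measurable.
Qed.

(** A leaf is alone on its orbit, so the tiles of the set of leaves are disjoint. *)
Lemma lebesgue_measure_leaf E : measurable E ->
  mu (leaf a E) = saturation_measure a (leaf a E).
Proof.
move=> mE; have mL := measurable_leaf a mE.
have mT n := measurable_tile a n mL.
rewrite measure_tiles// /saturation_measure -bigcup_tile measure_semi_bigcup//.
- apply/trivIsetP => i j _ _ ij; rewrite -subset0 => x [[_ [Ei _]] [_ [_ Ej]]].
  move/eqP: ij; apply; apply: (bij_inj int_of_nat_bij); apply/eqP.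
  by rewrite -subr_eq0; apply/eqP/Ej; rewrite mulrzBr opprB addrA subrK.
- exact: bigcupT_measurable.
Qed.

(** Every vertex met has degree at least 2, so the tiles cover it twice. *)
Lemma lebesgue_measure_no_leaf E : measurable E -> leaf a E = set0 ->
  (saturation_measure a E + saturation_measure a E <= mu E)%E.
Proof.
move=> mE L0; rewrite [leRHS]measure_tiles//.
apply: measure_covered_twice => [|n|x [xa [k Ek]]].
- by apply: measurableI => //; exact: measurable_saturation.
- exact: measurable_tile.
have [g _ gK] := int_of_nat_bij.
have [j [j0 Ej]] : exists j, j <> 0 /\ E (x - a *~ k - a *~ j).
  apply: contrapT => no_j; have : leaf a E (x - a *~ k).
    split=> // j Ej; apply: contrapT => j0; apply: no_j; exists j; split=> //.
  by rewrite L0.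
exists (g k), (g (k + j)); split.
- move=> /(can_inj gK)/eqP; rewrite -subr_eq0 opprD addrA subrr sub0r.
  by rewrite oppr_eq0 => /eqP.
- by split=> //=; rewrite gK.
- by split=> //=; rewrite gK mulrzDr opprD addrA.
Qed.

(** Borel-Cantelli: the measures of the tiles add up to [mu E], which is finite, so almost no point
    lies in infinitely many tiles. *)
Lemma infinite_orbit_null E : measurable E -> (mu E < +oo)%E ->
  mu.-negligible [set x | infinite_set (orbit_in a E x)].
Proof.
move=> mE finE.
have [g gK gK'] := int_of_nat_bij.
have mL : measurable (lim_sup_set (tile a E)).
  apply: bigcap_measurable => // n _; apply: bigcup_measurable => k _.
  exact: measurable_tile.
have L0 : mu (lim_sup_set (tile a E)) = 0.
  apply: lim_sup_set_cvg0 => [k|]; first exact: measurable_tile.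
  by rewrite -measure_tiles.
(* The limsup of the tiles lies in [[0, a[]; its translates reach the other points. *)
have sub : [set x | infinite_set (orbit_in a E x)] `<=` \bigcup_n
    [set x | lim_sup_set (tile a E) (x - a *~ int_of_nat n)].
  move=> x xinf; pose k := - Num.floor (x / a).
  have xk : x + a *~ k \in `[0, a[ by rewrite fundamental_domainE opprK.
  exists (g (- k)) => //=; rewrite gK' mulrNz opprK => n _.
  apply: contrapT => xn; apply: xinf.
  rewrite -(finite_orbit_in_shift a E x (- k)).
  apply: (sub_finite_set _ (finite_image int_of_nat (finite_II n))).
  move=> i Ei; exists (g i); last by rewrite gK'.
  rewrite /= ltnNge; apply/negP => ni; apply: xn; exists (g i) => //.
  by split=> //=; rewrite gK'; move: Ei; rewrite mulrNz opprK.
apply: (negligibleS (mu := mu) sub); apply: negligible_bigcup => n.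
apply/negligibleP.
  exact: measurable_translate.
by rewrite -[RHS]L0; exact: lebesgue_measure_translate.
Qed.

End fundamental_domain.

Lemma negligible_saturation {R : realType} (a : R) (N : set R) :
  (@lebesgue_measure R).-negligible N ->
  (@lebesgue_measure R).-negligible (saturation a N).
Proof.
move=> [A [mA A0 NA]].
have -> : saturation a N = \bigcup_n [set x | N (x - a *~ int_of_nat n)].
  have [g _ gK] := int_of_nat_bij.
  apply/seteqP; split=> x [k].
    by move=> Nk; exists (g k) => //=; rewrite gK.
  by move=> _ Nk; exists (int_of_nat k).
apply: negligible_bigcup => n; exists [set x | A (x - a *~ int_of_nat n)].
split; first exact: measurable_translate.
  by rewrite -A0; exact: lebesgue_measure_translate.
by move=> x; exact: NA.
Qed.

(** * Leaves and vertices in measure *)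

Section leaf_measure.
Context {R : realType} {a : R} (a_gt0 : 0 < a).
Implicit Types (E : set R).
Notation mu := (@lebesgue_measure R).

Lemma saturation_measure_le E :
  measurable E -> (saturation_measure a E <= a%:E)%E.
Proof.
move=> mE; apply: (@le_trans _ _ (mu `[0, a[%classic)); last first.
  by rewrite lebesgue_measure_itv /= lte_fin a_gt0 oppr0 adde0.
apply: le_measure; rewrite ?inE; last exact: subIsetl.
  by apply: measurableI => //; exact: measurable_saturation.
exact: measurable_itv.
Qed.

(** Each vertex met carries either a single leaf or only non-leaves, and leaves have the same
    measure as their vertices. *)
Lemma saturation_measure_leaf E : measurable E ->
  (saturation_measure a E =
    saturation_measure a (E `\` leaf a E) + mu (leaf a E))%E.
Proof.
move=> mE; have mL := measurable_leaf a mE.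
have mD : measurable (E `\` leaf a E) by exact: measurableD.
rewrite lebesgue_measure_leaf// /saturation_measure -measureU.
- rewrite -setIUr; congr (mu (_ `&` _)); apply/seteqP; split=> [x [k Ek]|x].
    by have [Lk|nLk] := pselect (leaf a E (x - a *~ k)); [right|left]; exists k.
  by case; apply: saturationS => y [].
- by apply: measurableI => //; exact: measurable_saturation.
- by apply: measurableI => //; exact: measurable_saturation.
- rewrite -subset0 => x [[_ [k [Ek nLk]]] [_ Lx]]; apply: nLk.
  by apply: leaf_saturation => //; apply/saturation_shift.
Qed.

Lemma leaf_setD_leaf E : leaf a (E `\` leaf a E) = set0.
Proof.
rewrite -subset0 => x [[Ex nLx] x1]; apply: (nLx); split=> // k Ek.
by apply: x1; split=> // Lk; apply/nLx/leaf_saturation => //; exists k.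
Qed.

(** Discarding the leaves changes no degree at the other vertices, so these still have degree at
    least 2 and account for twice their measure in edges. *)
Lemma le_lebesgue_measure_leaf E : measurable E ->
  (saturation_measure a (E `\` leaf a E) + saturation_measure a (E `\` leaf a E)
    + mu (leaf a E) <= mu E)%E.
Proof.
move=> mE; have mL := measurable_leaf a mE.
rewrite [leRHS](measureDI mu mE mL).
rewrite (_ : E `&` leaf a E = leaf a E); last by apply/setIidPr => x [].
apply: leeD => //; apply: lebesgue_measure_no_leaf => //.
  exact: measurableD.
exact: leaf_setD_leaf.
Qed.

End leaf_measure.

(** * Comparing edges with vertices by repeated pruning *)

Section edge_count.
Context {R : realType} {W : zmodType} (f : R -> W).
Context {a b : R} {p q : W} (a_gt0 : 0 < a) (b_gt0 : 0 < b).
Implicit Types (E : set R).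
Notation mu := (@lebesgue_measure R).
Hypothesis pq_free : forall m n : nat, p *+ m = q *+ n -> m = 0%N /\ n = 0%N.

Lemma lebesgue_measure_trim E : measurable E ->
  pruned_sums f a p q E -> pruned_sums f b q p E ->
  mu E = (mu (trim a b E) + (mu (leaf a E) + mu (leaf b E)))%E.
Proof.
move=> mE Ea Eb.
have mLa := measurable_leaf a mE; have mLb := measurable_leaf b mE.
rewrite -measureU//; last exact: leaf_disjoint pq_free _ Ea Eb.
rewrite (@measureDI _ _ _ mu E (leaf a E `|` leaf b E))//.
  by congr (_ + mu _)%E; apply/setIidPr => x [] [].
exact: measurableU.
Qed.

Let vertices E := (saturation_measure a E + saturation_measure b E)%E.

(* Pruning preserves [mu E - vertices E], and twice this difference is at least
   minus the measure of the leaves pruned; these measures add up to at most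
   [vertices E]. *)
Lemma edge_count_ge n E : measurable E -> (mu E < +oo)%E ->
  pruned_sums f a p q E -> pruned_sums f b q p E ->
  0 <= (fine (mu E) - fine (vertices E)) *+ 2 *+ n + fine (vertices E).
Proof.
elim: n E => [|n IHn] E mE finE Ea Eb.
  by rewrite mulr0n add0r; apply: fine_ge0; exact: adde_ge0.
have qp_free m k : q *+ m = p *+ k -> m = 0%N /\ k = 0%N.
  by move=> /esym/pq_free[].
have fin (F : set R) : measurable F -> F `<=` E -> mu F = (fine (mu F))%:E.
  move=> mF FE; rewrite fineK// ge0_fin_numE//; apply: le_lt_trans finE.
  by apply: le_measure; rewrite ?inE.
have sat_fin (c : R) (F : set R) : 0 < c -> measurable F ->
    saturation_measure c F = (fine (saturation_measure c F))%:E.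
  move=> c_gt0 mF; rewrite fineK// ge0_fin_numE//.
  by rewrite (le_lt_trans (saturation_measure_le c_gt0 mF))// ltry.
have mT := measurable_trim a b mE.
have mu_T : mu (trim a b E) = (fine (mu (trim a b E)))%:E.
  by apply: fin => // x [].
have mu_La : mu (leaf a E) = (fine (mu (leaf a E)))%:E.
  by apply: fin => [|x []//]; exact: measurable_leaf.
have mu_Lb : mu (leaf b E) = (fine (mu (leaf b E)))%:E.
  by apply: fin => [|x []//]; exact: measurable_leaf.
have Ta := pruned_sums_trim Ea Eb.
have Tb := pruned_sums_trim Eb Ea; rewrite trimC in Tb.
have finT : (mu (trim a b E) < +oo)%E by rewrite mu_T ltry.
have sat_Ta := saturation_trim pq_free Ea Eb.
have sat_Tb := saturation_trim qp_free Eb Ea; rewrite trimC in sat_Tb.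
have muE := lebesgue_measure_trim mE Ea Eb.
have va_E : saturation_measure a E =
    (saturation_measure a (trim a b E) + mu (leaf a E))%E.
  by rewrite /saturation_measure sat_Ta; exact: saturation_measure_leaf.
have vb_E : saturation_measure b E =
    (saturation_measure b (trim a b E) + mu (leaf b E))%E.
  by rewrite /saturation_measure sat_Tb; exact: saturation_measure_leaf.
have va_T : (saturation_measure a (trim a b E)
    + saturation_measure a (trim a b E) + mu (leaf a E) <= mu E)%E.
  by rewrite /saturation_measure sat_Ta; exact: le_lebesgue_measure_leaf.
have vb_T : (saturation_measure b (trim a b E)
    + saturation_measure b (trim a b E) + mu (leaf b E) <= mu E)%E.
  by rewrite /saturation_measure sat_Tb; exact: le_lebesgue_measure_leaf.
have := IHn _ mT finT Ta Tb; move: va_T vb_T.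
rewrite /vertices va_E vb_E muE (sat_fin a _ a_gt0 mT) (sat_fin b _ b_gt0 mT).
rewrite mu_T mu_La mu_Lb -!EFinD !lee_fin /= [_ *+ n.+1]mulrS.
move: (fine (mu (trim a b E))) (fine (mu (leaf a E))) (fine (mu (leaf b E))).
move: (fine (saturation_measure a _)) (fine (saturation_measure b _)).
move=> va vb m la lb le_a le_b.
have -> : m + (la + lb) - (va + la + (vb + lb)) = m - (va + vb) by lra.
(* The sum of [le_a] and [le_b] reads [0 <= (m - (va + vb)) *+ 2 + la + lb], which is exactly what
   the goal adds to the induction hypothesis. *)
by move: (_ *+ n) => w; lra.
Qed.

(** The bound of [edge_count_ge] holds for every [n]; a negative difference would violate it once
    [n] exceeds [vertices E] divided by [x]. *)
Lemma edge_count E : measurable E -> (mu E < +oo)%E ->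
  pruned_sums f a p q E -> pruned_sums f b q p E ->
  (saturation_measure a E + saturation_measure b E <= mu E)%E.
Proof.
move=> mE finE Ea Eb.
have v_fin : vertices E \is a fin_num.
  rewrite ge0_fin_numE; last exact: adde_ge0.
  apply: (@le_lt_trans _ _ (a%:E + b%:E)%E); last by rewrite -EFinD ltry.
  by apply: leeD; exact: saturation_measure_le.
have m_fin : mu E \is a fin_num by rewrite ge0_fin_numE.
rewrite -/(vertices E) -(fineK v_fin) -(fineK m_fin).
rewrite lee_fin leNgt; apply/negP => lt_mv.
set x := (fine (vertices E) - fine (mu E)) *+ 2.
have x_gt0 : 0 < x by rewrite pmulrn_lgt0// subr_gt0.
have v_ge0 : 0 <= fine (vertices E) by apply: fine_ge0; exact: adde_ge0.
have := archi_boundP (divr_ge0 v_ge0 (ltW x_gt0)).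
rewrite ltr_pdivrMr// mulr_natl ltNge => /negP; apply.
have := edge_count_ge (Num.bound (fine (vertices E) / x)) mE finE Ea Eb.
by rewrite -opprB mulNrn mulNrn -/x addrC subr_ge0.
Qed.

End edge_count.

(** * From the analytic hypotheses to a graph with finite degrees *)

Lemma totally_sum_finite {K : numFieldType} {U : normedModType K}
    {I : choiceType} (u : I -> U) (s : U) (D : set I) :
  finite_set D -> (forall k, ~ D k -> u k = 0) ->
  partial_sum u @ totally --> s -> \sum_(k \in D) u k = s.
Proof.
move=> finD uD us; have totF := @totally_filter I.
(* All finite sets containing [D] give the same partial sum, so the net is eventually constant. *)
apply: (cvg_unique (@norm_hausdorff _ U) _ us); apply: cvg_near_cst.
exists (fset_set D) => // B /= DB.
rewrite /partial_sum -(finmap.big_seq_fsetE _ B xpredT u).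
apply/esym/fsbig_fwiden => [k Dk||k [_ /uD//]]; last exact: finmap.fset_uniq.
by apply: (finmap.fsubsetP DB); rewrite in_fset_set//; exact: mem_set.
Qed.

Lemma proportional_free {K : numFieldType} (p q : K) :
  (~ exists n m : nat, proportional (p, q) (n%:R, m%:R)) ->
  forall m n : nat, p *+ m = q *+ n -> m = 0%N /\ n = 0%N.
Proof.
move=> npq m n pq; have [m0|m_neq0] := eqVneq m 0%N; last first.
  exfalso; apply: npq; exists n, m; exists (q / m%:R).
  rewrite /= divfK ?pnatr_eq0//.
  by rewrite mulrAC mulr_natr -pq -[p *+ m]mulr_natr mulfK ?pnatr_eq0.
split=> //; have [//|n_neq0] := eqVneq n 0%N.
(* Here [q] vanishes, and [(p, 0)] is [p] times [(1, 0)]. *)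
exfalso; apply: npq; exists 1%N, 0%N, p.
move: pq => /esym/eqP; rewrite m0 mulr0n mulrn_eq0 (negPf n_neq0) => /eqP -> /=.
by rewrite mulr1 mulr0.
Qed.

Section lebesgue_measurable.
Context {R : realType}.
Notation mu := (@lebesgue_measure R).

(** The complement of 0 is open, so the support is Caratheodory measurable, that is, Borel up to a
    null set. *)
Lemma lebesgue_measurable_supp (f : R -> R[i]) : lebesgue_measurable_fun f ->
  exists A N : set R,
    [/\ measurable A, mu.-negligible N & A `|` N = [set x | f x != 0]].
Proof.
move=> mf.
have : (wlength (@idfun R))^*%mu.-cara.-measurable [set x : R | f x != 0].
  rewrite (_ : [set _ | _] = setT `&` f @^-1` (~` [set 0])); last first.
    by rewrite setTI; apply/seteqP; split=> x /= => [/eqP|] // /eqP.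
  apply: mf => //; apply: sub_sigma_algebra; rewrite /= openC.
  apply: accessible_closed_set1; apply: hausdorff_accessible.
  exact: (@norm_hausdorff _ R[i]^o).
rewrite -completed_caratheodory_measurable g_sigma_completed_algebra_genE.
by move=> [A mA [N nN AN]]; exists A, N.
Qed.

Lemma completed_negligible (N : set R) :
  (@completed_lebesgue_measure R).-negligible N -> mu.-negligible N.
Proof.
move=> [A [mA A0 NA]]; apply/negligible_outer_measure.
apply/eqP; rewrite eq_le outer_measure_ge0 andbT -A0.
exact: le_outer_measure.
Qed.

Lemma le_completed_lebesgue_measure (A B : set R) :
  A `<=` B -> (mu A <= @completed_lebesgue_measure R B)%E.
Proof. by move=> AB; exact: le_outer_measure. Qed.

End lebesgue_measurable.

Lemma saturation_measure_conull {R : realType} (a : R) (E Z : set R) :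
  0 < a -> measurable E -> measurable Z -> lebesgue_measure Z = 0 ->
  (forall x, ~ Z x -> saturation a E x) -> (a%:E <= saturation_measure a E)%E.
Proof.
move=> a_gt0 mE mZ Z0 ZE.
pose I : set R := `[0, a[ `&` saturation a E.
have mI : measurable I.
  by apply: measurableI => //; exact: measurable_saturation.
have <- : @lebesgue_measure R `[0, a[ = a%:E.
  by rewrite lebesgue_measure_itv /= lte_fin a_gt0 oppr0 adde0.
have : (lebesgue_measure (I `|` Z) <=
    saturation_measure a E + lebesgue_measure Z)%E by exact: measureU2.
rewrite Z0 adde0; apply: le_trans.
apply: le_measure; rewrite ?inE.
- exact: measurable_itv.
- exact: measurableU.
- by move=> x xa; have [|/ZE] := pselect (Z x); [right|left].
Qed.

(** The orbit of a point off [Z] avoids [Z] by invariance, so removing [Z] loses no term there and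
    the limit is a finite sum. *)
Lemma orbit_sum_off_null {R : realType} (f : R -> R[i]) (a : R) (p : R[i])
    (A Z : set R) :
  (forall x k, Z (x - a *~ k) -> Z x) ->
  (forall x, ~ Z x -> finite_set (orbit_in a A x)) ->
  (forall x, ~ Z x -> f x != 0 -> A x) ->
  (forall x, ~ Z x -> abs_sums_to (fun k : int => f (x - k%:~R * a)) p) ->
  forall x, ~ Z x ->
    finite_set (orbit_in a (A `\` Z) x) /\ orbit_sum f a (A `\` Z) x = p.
Proof.
move=> aZ finA fA fp x Zx.
have fin : finite_set (orbit_in a (A `\` Z) x).
  by apply: sub_finite_set (finA _ Zx) => k [].
split=> //; apply: (@totally_sum_finite _ R[i]^o) => //.
  move=> k nk; apply: contrapT => /eqP fk; apply: nk.
  have nZ : ~ Z (x - a *~ k) by move=> /aZ.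
  by split=> //; exact: fA.
have [_] := fp _ Zx.
rewrite (_ : (fun k : int => _) = fun k => f (x - a *~ k))//.
by apply/funext => k; rewrite mulrzl.
Qed.

Theorem theorem2p3 (R : realType) (alpha beta : R) (p q : R[i])
    (f : R -> R[i]) :
  0 < alpha -> 0 < beta -> rationally_independent alpha beta ->
  (~ exists n m : nat, proportional (p, q) (n%:R, m%:R)) ->
  lebesgue_measurable_fun f ->
  {ae @completed_lebesgue_measure R, forall x : R,
    abs_sums_to (fun k : int => f (x - k%:~R * alpha)) p} ->
  {ae @completed_lebesgue_measure R, forall x : R,
    abs_sums_to (fun k : int => f (x - k%:~R * beta)) q} ->
  ((alpha + beta)%:E <=
    @completed_lebesgue_measure R [set x : R | (f x != 0)%R])%E.
Proof.
move=> a_gt0 b_gt0 _ npq mf fa fb; have pq_free := proportional_free npq.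
have [A [N [mA nN AN]]] := lebesgue_measurable_supp mf.
set S := [set x | _] in AN *.
have [S_oo|S_fin] := leP +oo%E (@completed_lebesgue_measure R S).
  by apply: le_trans S_oo; exact: leey.
have AS : A `<=` S by rewrite -AN; exact: subsetUl.
have A_fin : (lebesgue_measure A < +oo)%E.
  exact: le_lt_trans (le_completed_lebesgue_measure AS) S_fin.
have [M [mM M0 badM]] := negligibleU (negligibleU nN
  (negligibleU (completed_negligible fa) (completed_negligible fb)))
  (negligibleU (infinite_orbit_null a_gt0 mA A_fin)
    (infinite_orbit_null b_gt0 mA A_fin)).
(* Saturating along both translations makes the bad set invariant under both and keeps it null; off
   [Z] all properties hold along whole orbits. *)
pose Z := saturation beta (saturation alpha M).
have mZ : measurable Z by do 2!apply: measurable_saturation.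
have Z0 : lebesgue_measure Z = 0.
  apply/negligibleP => //; do 2!apply: negligible_saturation.
  exact/negligibleP.
have ZM x : ~ Z x -> ~ M x.
  by move=> Zx Mx; apply: Zx; do 2!apply: sub_saturation.
have Zb x k : Z (x - beta *~ k) -> Z x by move=> /saturation_shift.
have Za x k : Z (x - alpha *~ k) -> Z x.
  by move=> [l]; rewrite addrAC => /saturation_shift; exists l.
have fA x : ~ Z x -> f x != 0 -> A x.
  move=> Zx fx; have [//|Nx] : (A `|` N) x by rewrite AN.
  by exfalso; apply: (ZM _ Zx); apply: badM; left; left.
have sum_a x : ~ Z x -> finite_set (orbit_in alpha (A `\` Z) x) /\
    orbit_sum f alpha (A `\` Z) x = p.
  apply: orbit_sum_off_null Za _ fA _ x => x /ZM nMx; apply: contrapT => bad.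
    by apply/nMx/badM; right; left.
  by apply/nMx/badM; left; right; left.
have sum_b x : ~ Z x -> finite_set (orbit_in beta (A `\` Z) x) /\
    orbit_sum f beta (A `\` Z) x = q.
  apply: orbit_sum_off_null Zb _ fA _ x => x /ZM nMx; apply: contrapT => bad.
    by apply/nMx/badM; right; right.
  by apply/nMx/badM; left; right; right.
have mE : measurable (A `\` Z) by exact: measurableD.
(* Before any pruning each tree is a single vertex, with counts 1 and 0. *)
have pruned_a : pruned_sums f alpha p q (A `\` Z).
  move=> x [_ /sum_a[fin ->]]; split=> //.
  by exists 0%N, 0%N; rewrite mulr0n subr0.
have pruned_b : pruned_sums f beta q p (A `\` Z).
  move=> x [_ /sum_b[fin ->]]; split=> //.
  by exists 0%N, 0%N; rewrite mulr0n subr0.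
(* An orbit without edges would have sum 0, hence [p = 0], contrary to [pq_free]. *)
have sat_a x : ~ Z x -> saturation alpha (A `\` Z) x.
  move=> /sum_a[_]; have [orb0|/set0P[k Ek _]] :=
    eqVneq (orbit_in alpha (A `\` Z) x) set0; last by exists k.
  rewrite /orbit_sum orb0 fsbig_set0 => p0.
  by have [] := pq_free 1%N 0%N (esym p0).
have sat_b x : ~ Z x -> saturation beta (A `\` Z) x.
  move=> /sum_b[_]; have [orb0|/set0P[k Ek _]] :=
    eqVneq (orbit_in beta (A `\` Z) x) set0; last by exists k.
  rewrite /orbit_sum orb0 fsbig_set0 => q0.
  by have [] := pq_free 0%N 1%N q0.
have E_fin : (lebesgue_measure (A `\` Z) < +oo)%E.
  by apply: le_lt_trans A_fin; apply: le_measure; rewrite ?inE.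
have ES : A `\` Z `<=` S by move=> x [/AS].
apply: le_trans (le_completed_lebesgue_measure ES).
apply: le_trans (edge_count a_gt0 b_gt0 pq_free mE E_fin pruned_a pruned_b).
rewrite EFinD; apply: leeD.
- exact: saturation_measure_conull a_gt0 mE mZ Z0 sat_a.
- exact: saturation_measure_conull b_gt0 mE mZ Z0 sat_b.
Qed.
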